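(* Let $G$ be a finitely generated group and let $(X,G,\Phi,\mu)$ be a minimal equicontinuous action of $G$ on a Cantor set $X$, where $\mu$ is its unique invariant probability measure. If $(X,G,\Phi,\mu)$ is locally non-degenerate and topologically free, then it is essentially free.
   Context: Actions. An action $(X,G,\Phi)$ is a homomorphism $\Phi:G\to \mathrm{Homeo}(X)$, with $g\cdot x=\Phi(g)(x)$. It is minimal if every orbit is dense. It is equicontinuous if $X$ admits a compatible metric $d$ such that for all $\epsilon>0$ there is $\delta>0$ such that $d(x,y)<\delta$ implies $d(g\cdot x,g\cdot y)<\epsilon$ for all $g\in G$. A minimal equicontinuous action is uniquely ergodic, and $\mu$ denotes its unique invariant Borel probability measure. Freeness. $G_x=\{g\in G\mid g\cdot x=x\}$ is the stabilizer of $x$; it is trivial if $G_x=\{e\}$. The action is topologically free if the set of points with non-trivial stabilizer is meager in $X$. It is essentially free if the set of points with trivial stabilizer has full $\mu$-measure in $X$. Trees. A rooted spherically homogeneous tree $T$ with spherical index $(n_1,n_2,\ldots)$, where each $n_\ell\ge 2$ is an integer, has vertex set $V=\bigsqcup_{\ell\ge0}V_\ell$ with $|V_0|=1$; every vertex of $V_{\ell-1}$ is joined by edges to exactly $n_\ell$ vertices of $V_\ell$, and every vertex of $V_{\ell}$ is joined to exactly one vertex of $V_{\ell-1}$ ($\ell\ge 1$). The boundary $\partial T$ is the Cantor set of infinite paths $(v_\ell)_{\ell\ge0}$, $v_\ell\in V_\ell$, with consecutive vertices joined by an edge (topology induced from $\prod_\ell V_\ell$). For $v\in V$, $\partial T_v\subset\partial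 T$ is the clopen set of paths through $v$. The counting measure $\mu_{\partial T}$ is the Borel probability measure with $\mu_{\partial T}(\partial T_v)=1/(n_1\cdots n_\ell)$ for $v\in V_\ell$. Every $g\in \mathrm{Aut}(T)$ (root- and level-preserving automorphisms) induces a homeomorphism of $\partial T$. Locally non-degenerate. The action of $g\in \mathrm{Aut}(T)$ on $\partial T$ is locally non-degenerate if there exists $0<\alpha_g\le1$ such that for any vertex $v\in V$, if $g$ fixes $v$ and $g|\partial T_v\neq \mathrm{id}$, then $\mu_{\partial T}(\{\mathbf w\in\partial T_v\mid g\cdot\mathbf w\ne\mathbf w\})\ge \alpha_g\,\mu_{\partial T}(\partial T_v)$. The action of a subgroup of $\mathrm{Aut}(T)$ on $\partial T$ is locally non-degenerate if the action of each of its elements is. A minimal equicontinuous action $(X,G,\Phi,\mu)$ is locally non-degenerate if there exist a rooted spherically homogeneous tree $T$ and a homeomorphism $\phi:X\to\partial T$ such that for every $g\in G$ the map $\phi\circ\Phi(g)\circ\phi^{-1}$ is induced by an automorphism of $T$, and the resulting action of the group $\{\phi\circ\Phi(g)\circ\phi^{-1}\mid g\in G\}$ on $\partial T$ is locally non-degenerate. (Under such $\phi$, $\mu$ is pushed forward to $\mu_{\partial T}$.) *)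

(* Defs.v *)
From HB Require Import structures.
From mathcomp Require Import all_boot all_order all_algebra.
From mathcomp Require Import all_classical all_reals all_analysis.

Set Implicit Arguments.
Unset Strict Implicit.
Unset Printing Implicit Defensive.

Import Order.TTheory GRing.Theory Num.Theory.

Local Open Scope classical_set_scope.
Local Open Scope ring_scope.

Definition finitely_generated (G : groupType) :=
  exists s : seq G, forall H : {pred G},
    group_closed H -> {subset s <= H} -> forall g, g \in H.

Section Topology.

Definition homeomorphism (X Y : topologicalType) (f : X -> Y) :=
  continuous f /\ exists g : Y -> X, [/\ continuous g, cancel f g & cancel g f].

Definition cantor_set (X : topologicalType) :=
  exists f : X -> cantor_space, homeomorphism f.

Definition nowhere_dense (X : topologicalType) (A : set X) :=
  interior (closure A) = set0.

Definition meager (X : topologicalType) (A : set X) :=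
  exists F : nat -> set X,
    (forall n, nowhere_dense (F n)) /\ A `<=` \bigcup_n F n.

Definition compatible_metric (R : realType) (X : topologicalType)
    (d : X -> X -> R) :=
  [/\ forall x y, d x y = 0 <-> x = y,
      forall x y, d x y = d y x,
      forall x y z, d x z <= d x y + d y z &
      forall x (A : set X),
        nbhs x A <-> exists2 e : R, 0 < e & [set y | d x y < e] `<=` A].

End Topology.

Notation Borel X := (g_sigma_algebraType (@open X)).

Section Actions.

(* A homomorphism from G to Homeo(X); that 1 acts as the identity follows from
   the two axioms. *)
Record homeo_action (G : groupType) (X : topologicalType) := HomeoAction {
  act_fun :> G -> X -> X;
  act_homeo : forall g, homeomorphism (act_fun g);
  act_mul : forall (g h : G) x,
    act_fun (g * h)%g x = act_fun g (act_fun h x)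
}.

Definition minimal_action (G : groupType) (X : topologicalType)
    (Phi : homeo_action G X) :=
  forall x, dense [set Phi g x | g in [set: G]].

Definition equicontinuous_action (R : realType) (G : groupType)
    (X : topologicalType) (Phi : homeo_action G X) :=
  exists d : X -> X -> R, compatible_metric d /\
    forall e : R, 0 < e -> exists2 delta : R, 0 < delta &
      forall x y, d x y < delta -> forall g, d (Phi g x) (Phi g y) < e.

Definition stabilizer (G : groupType) (X : topologicalType)
    (Phi : homeo_action G X) (x : X) : set G :=
  [set g | Phi g x = x].

Definition trivial_stabilizer (G : groupType) (X : topologicalType)
    (Phi : homeo_action G X) (x : X) :=
  stabilizer Phi x = [set 1%g].

Definition topologically_free (G : groupType) (X : topologicalType)
    (Phi : homeo_action G X) :=
  meager [set x | ~ trivial_stabilizer Phi x].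

(* Uniqueness is not part of the definition: for a minimal equicontinuous
   action on a Cantor set there is exactly one such measure. *)
Definition invariant_measure (R : realType) (G : groupType)
    (X : ptopologicalType) (Phi : homeo_action G X)
    (mu : probability (Borel X) R) :=
  forall (g : G) (A : set (Borel X)), measurable A ->
    mu (Phi g @^-1` A) = mu A.

Definition essentially_free (R : realType) (G : groupType)
    (X : ptopologicalType) (Phi : homeo_action G X)
    (mu : probability (Borel X) R) :=
  {ae mu, forall x, trivial_stabilizer Phi x}.

End Actions.

(* [vertex l] is the level V_l, [edge] relates V_l to V_{l+1}, and
   [spherical_index l] is the integer n_{l+1}. *)
Record spherical_tree := SphericalTree {
  spherical_index : nat -> nat;
  vertex : nat -> finType;
  edge : forall l, vertex l -> vertex l.+1 -> bool;
  spherical_index_ge2 : forall l, (2 <= spherical_index l)%N;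
  card_root : #|vertex 0| = 1%N;
  card_children : forall l (v : vertex l),
    #|[pred w | edge v w]| = spherical_index l;
  card_parents : forall l (w : vertex l.+1), #|[pred v | edge v w]| = 1%N
}.

Section Boundary.
Variable T : spherical_tree.

Definition tree_path : set (prod_topology
    (fun l => discrete_topology (vertex T l))) :=
  [set w | forall l, edge (w l : vertex T l) (w l.+1 : vertex T l.+1)].

Definition boundary : Type := set_type tree_path.

HB.instance Definition _ := Topological.copy boundary (set_type tree_path).

Lemma exists_root : exists v : vertex T 0, true.
Proof.
have /card_gt0P[v _] : (0 < #|vertex T 0|)%N by rewrite card_root.
by exists v.
Qed.

Lemma exists_child l (v : vertex T l) : exists w, edge v w.
Proof.
have /card_gt0P[w vw] : (0 < #|[pred w | edge v w]|)%N.
  by rewrite card_children (leq_trans _ (spherical_index_ge2 T l)).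
by exists w.
Qed.

Fixpoint some_path l : vertex T l :=
  if l is l'.+1 then xchoose (exists_child (some_path l'))
  else xchoose exists_root.

Lemma some_path_subproof : some_path \in tree_path.
Proof. by apply/mem_set => l; exact: xchooseP. Qed.

(* [measurableType] requires a pointed carrier. *)
HB.instance Definition _ :=
  isPointed.Build boundary (SigSub some_path_subproof).

Definition cylinder l (v : vertex T l) : set boundary :=
  [set w | \val w l = v].

Record tree_aut := TreeAut {
  aut_fun :> forall l, vertex T l -> vertex T l;
  aut_bij : forall l, bijective (@aut_fun l);
  aut_edge : forall l (v : vertex T l) (w : vertex T l.+1),
    edge (aut_fun v) (aut_fun w) = edge v w
}.

Lemma aut_act_subproof (a : tree_aut) (w : boundary) :
  (fun l => a l (\val w l)) \in tree_path.
Proof. by apply/mem_set => l; rewrite /= aut_edge; exact: set_valP w l. Qed.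

Definition aut_act (a : tree_aut) (w : boundary) : boundary :=
  SigSub (aut_act_subproof a w).

(* These values determine the Borel probability measure, so [m] is the counting
   measure on the boundary. *)
Definition counting_measure (R : realType)
    (m : probability (Borel boundary) R) :=
  forall l (v : vertex T l),
    m (cylinder v) = ((\prod_(i < l) spherical_index T i)%N%:R^-1)%:E.

Definition locally_nondegenerate_aut (R : realType)
    (m : probability (Borel boundary) R) (a : tree_aut) :=
  exists2 alpha : R, 0 < alpha <= 1 &
    forall l (v : vertex T l), a l v = v ->
      (exists2 w, cylinder v w & aut_act a w <> w) ->
      (alpha%:E * m (cylinder v)
        <= m [set w | cylinder v w /\ aut_act a w <> w])%E.

Definition locally_nondegenerate_set (R : realType)
    (m : probability (Borel boundary) R) (H : set tree_aut) :=
  forall a, H a -> locally_nondegenerate_aut m a.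

End Boundary.

Section LocallyNondegenerate.
Variables (G : groupType) (X : topologicalType) (Phi : homeo_action G X).

(* [a] induces phi o Phi(g) o phi^-1 on the boundary. *)
Definition induces (T : spherical_tree) (phi : X -> boundary T) (g : G)
    (a : tree_aut T) :=
  forall x, phi (Phi g x) = aut_act a (phi x).

Definition induced_group (T : spherical_tree) (phi : X -> boundary T) :
    set (tree_aut T) :=
  [set a | exists g, induces phi g a].

Definition locally_nondegenerate (R : realType) :=
  exists (T : spherical_tree) (phi : X -> boundary T)
         (m : probability (Borel (boundary T)) R),
    [/\ homeomorphism phi,
        counting_measure m,
        forall g, exists a, induces phi g a &
        locally_nondegenerate_set m (induced_group phi)].

End LocallyNondegenerate.

(* Main.v *)
(* If [g <> 1], topological freeness and Baire's theorem make the fixed-point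
   set F of [g] nowhere dense, so [g] acts non-trivially below every vertex it
   fixes.  Let U_l be the union of the cylinders of the level-l vertices fixed
   by [g]; the U_l decrease to F.  Summing non-degeneracy over these vertices
   gives, for the counting measure m, alpha * m(F) <= alpha * m(U_l) <=
   m(U_l \ F), and the right-hand side tends to 0.  Since G is countable, the
   points with non-trivial stabilizer form a countable union of null sets. *)
Require Import Defs.
From mathcomp Require Import all_boot all_order all_algebra.
From mathcomp Require Import all_classical all_reals all_analysis.

Set Implicit Arguments.
Unset Strict Implicit.
Unset Printing Implicit Defensive.

Import Order.TTheory GRing.Theory Num.Theory.

Local Open Scope classical_set_scope.
Local Open Scope ring_scope.

(** * Baire category, enumeration of the group, and equal partitions *)

Lemma compact_hausdorff_baire (X : topologicalType) (U : set X) :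
  hausdorff_space X -> compact [set: X] -> open U -> meager U -> U = set0.
Proof.
move=> hX cX oU [F [ndF UF]].
(* One shrinking step, from the pair of an index [n] and a current open set. The hypothesis on that
   set sits under the existential so that [choice] yields a total function; [set0] is the junk
   value. *)
have step (nV : nat * set X) : exists W : set X,
    open nV.2 /\ nV.2 !=set0 ->
    [/\ open W, W !=set0, closure W `<=` nV.2 & closure W `&` F nV.1 = set0].
  case: nV => n V /=.
  case: (pselect (open V /\ V !=set0)) => [[oV [v Vv]]|nV]; last by exists set0.
  have [x [Vx nFx]] : V `&` ~` closure (F n) !=set0.
    apply: contrapT => VF; suff : interior (closure (F n)) v by rewrite ndF.
    rewrite /interior nbhsE; exists V => // y Vy; apply: contrapT => nFy.
    by apply: VF; exists y.
  have oW : open (V `&` ~` closure (F n)).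
    by apply: openI => //; exact/closed_openC/closed_closure.
  have [N nN clN] := compact_regular hX cX filterT
    (open_nbhs_nbhs (conj oW (conj Vx nFx))).
  have clW : closure (interior N) `<=` V `&` ~` closure (F n).
    by apply: subset_trans clN; apply: closureS; exact: interior_subset.
  exists (interior N) => _; split.
  - exact: open_interior.
  - by exists x.
  - by move=> y /clW[].
  - apply/seteqP; split => // y [/clW[_ nFy] Fy]; apply: nFy.
    exact: subset_closure.
have [s sP] := choice step.
rewrite -subset0 => u Uu.
pose W := fix W n := if n is n'.+1 then s (n', W n') else U.
have WP n : open (W n) /\ W n !=set0.
  elim: n => [|n IH]; first by split => //; exists u.
  by have [] := sP (n, W n) IH.
have Wdec n m : (n <= m)%N -> W m `<=` W n.
  move=> /subnK <-; elim: (m - n)%N => // k IH; apply: subset_trans IH.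
  have [_ _ clW _] := sP ((k + n)%N, W (k + n)%N) (WP (k + n)%N).
  by apply: subset_trans clW; exact: subset_closure.
(* The nested [W n] form a filter base, and compactness gives a cluster point [p] in every closure.
   Since the closure of [W n.+1] lies in [W n] and misses [F n], [p] is in [U] but in no [F n]. *)
have [||p [_ pW]] := cX (filter_from [set: nat] W).
- apply: filter_from_proper; last by move=> n _; case: (WP n).
  apply: filter_from_filter; first by exists 0%N.
  move=> i j _ _; exists (maxn i j) => // y Wy.
  by split; apply: Wdec Wy; rewrite ?leq_maxl ?leq_maxr.
- by exists 0%N.
have pcl n : closure (W n) p by move=> B /pW; apply; exists n.
have Up : U p by have [_ _ + _] := sP (0%N, U) (WP 0%N); apply; exact: (pcl 1%N).
have [n _ Fp] := UF p Up.
have [_ _ _ e] := sP (n, W n) (WP n).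
by suff : set0 p by []; rewrite -e; split => //; exact: (pcl n.+1).
Qed.

Lemma homeomorphism_hausdorff (X Y : topologicalType) (f : X -> Y) :
  homeomorphism f -> hausdorff_space Y -> hausdorff_space X.
Proof.
move=> [cf [g [_ fK _]]] hY x y xy; apply: (can_inj fK); apply: hY => A B.
by move=> /cf Ax /cf By; have [z [Az Bz]] := xy _ _ Ax By; exists (f z).
Qed.

Lemma homeomorphism_compact (X Y : topologicalType) (f : X -> Y) :
  homeomorphism f -> compact [set: Y] -> compact [set: X].
Proof.
move=> [_ [g [cg fK _]]] cY.
rewrite (_ : [set: X] = g @` [set: Y]).
  by apply: continuous_compact => //; exact: continuous_subspaceT.
by apply/seteqP; split => // x _; exists (f x).
Qed.

Lemma finitely_generated_countable (G : groupType) :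
  finitely_generated G -> exists f : nat -> G, forall g, exists n, f n = g.
Proof.
move=> [s sP].
(* A letter is a position in [s] with an inversion bit; positions past the end give 1. Words over
   this countable alphabet are enumerated by [unpickle], and their values form a subgroup containing
   [s]. *)
pose letter (p : nat * bool) := let g := nth 1%g s p.1 in
  if p.2 then g^-1%g else g.
pose word (w : seq (nat * bool)) : G := foldr (fun p g => letter p * g)%g 1%g w.
exists (fun n => oapp word 1%g (unpickle n)) => g.
suff [w <-] : exists w, word w = g by exists (pickle w); rewrite pickleK.
have wordM v w : word (v ++ w) = (word v * word w)%g.
  by elim: v => [|p v /= ->]; rewrite ?mul1g// mulgA.
have wordV w : exists v, word v = (word w)^-1%g.
  elim: w => [|[n b] w [v IH]]; first by exists [::]; rewrite /= invg1.
  exists (v ++ [:: (n, ~~ b)]); rewrite wordM IH /= mulg1 invgM /letter /=.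
  by case: b => //=; rewrite invgK.
pose H : {pred G} := [pred g | `[< exists w, word w = g >]].
suff /asboolP : g \in H by [].
apply: sP => [|h hs]; last first.
  apply/asboolP; exists [:: (index h s, false)].
  by rewrite /= /letter/= nth_index// mulg1.
split; first by apply/asboolP; exists [::].
move=> _ _ /asboolP[v <-] /asboolP[w <-]; apply/asboolP.
by have [w' <-] := wordV w; exists (v ++ w'); rewrite wordM.
Qed.

(** Applied below to [m] and to [mu]: both give a level-l cylinder the inverse of the number of
    level-l vertices, which is how the two measures are seen to agree there. *)
Lemma probability_equipartition (R : realType) (d : measure_display)
    (T : measurableType d) (P : probability T R) (I : finType) (A : I -> set T) :
  (forall i, measurable (A i)) -> trivIset setT A -> \bigcup_i A i = setT ->
  (forall i j, P (A i) = P (A j)) -> forall i, P (A i) = (#|I|%:R^-1)%:E.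
Proof.
move=> mA tA cA eA i.
have Afin j : P (A j) \is a fin_num by exact: fin_num_measure.
have : P (\bigcup_i A i) = 1%E by rewrite cA probability_setT.
rewrite measure_fin_bigcup//; last exact: finite_finset.
rewrite (eq_fsbigr (fun=> P (A i))) => [|j _]; last exact: eA.
rewrite (_ : [set: I] = [set` index_enum I]); last first.
  by apply/seteqP; split => // j _ /=; rewrite mem_index_enum.
rewrite -fsbig_seq ?index_enum_uniq//.
rewrite -(fineK (Afin i)) sumEFin => -[].
set c := fine _ => e; congr (_%:E).
have {}e : c * #|I|%:R = 1 by rewrite mulr_natr -e sumr_const.
have I0 : (#|I|%:R : R) != 0.
  by apply/eqP => z; move/eqP: e; rewrite z mulr0 eq_sym oner_eq0.
by apply: (mulIf I0); rewrite e mulVf.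
Qed.

(** * Fixed points of a tree automorphism and the counting measure *)

Section Boundary.
Variable T : spherical_tree.

Lemma open_cylinder l (v : vertex T l) : open (cylinder v).
Proof.
have cl : continuous (fun w : boundary T =>
    \val w l : discrete_topology (vertex T l)).
  move=> w; apply: (@continuous_comp _ _ _ (\val : boundary T -> _)
    (@proj _ (fun l => discrete_topology (vertex T l)) l)).
    exact: initial_continuous.
  exact: proj_continuous.
rewrite (_ : cylinder v = (fun w : boundary T => \val w l) @^-1` [set v])//.
by apply: open_comp => [w _|]; [exact: cl|exact: discrete_open].
Qed.

Lemma measurable_cylinder l (v : vertex T l) :
  measurable (cylinder v : set (Borel (boundary T))).
Proof. by apply: sub_sigma_algebra; exact: open_cylinder. Qed.

Lemma trivIset_cylinder l (D : set (vertex T l)) : trivIset D (@cylinder T l).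
Proof. by move=> u v _ _ [w [<- <-]]. Qed.

Lemma bigcup_cylinder l (D : set (vertex T l)) :
  \bigcup_(v in D) cylinder v = [set w | D (\val w l)].
Proof.
apply/seteqP; split=> [w [v Dv wv]|w Dw]; last by exists (\val w l).
by rewrite /= wv.
Qed.

Lemma edge_inj l (u v : vertex T l) (w : vertex T l.+1) :
  edge u w -> edge v w -> u = v.
Proof.
move=> uw vw; have [x xP] := mem_card1 (card_parents w).
by have := xP u; have := xP v; rewrite !inE uw vw => /esym/eqP-> /esym/eqP->.
Qed.

Lemma aut_inj (a : tree_aut T) l : injective (a l).
Proof. by have [b ab _] := aut_bij a l; exact: can_inj ab. Qed.

Definition fixed_points (a : tree_aut T) : set (boundary T) :=
  [set w | aut_act a w = w].

(** The set U_l as a pointwise condition; [fixed_to_levelE] recovers the union of cylinders. *)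
Definition fixed_to_level (a : tree_aut T) (l : nat) : set (boundary T) :=
  [set w | a l (\val w l) = \val w l].

Lemma bigcap_fixed_to_level (a : tree_aut T) :
  \bigcap_l fixed_to_level a l = fixed_points a.
Proof.
apply/seteqP; split => w.
  move=> aw; apply: val_inj; apply: functional_extensionality_dep => l.
  exact: aw.
by move=> aw l _; rewrite /fixed_to_level /= -[in RHS]aw.
Qed.

(** Automorphisms preserve edges and parents are unique, so fixing a vertex forces fixing its
    parent. *)
Lemma fixed_to_levelS (a : tree_aut T) l :
  fixed_to_level a l.+1 `<=` fixed_to_level a l.
Proof.
move=> w /= aw; apply: (@edge_inj _ _ _ (\val w l.+1)); last exact: set_valP w l.
by rewrite -aw aut_edge; exact: set_valP w l.
Qed.

Lemma fixed_to_levelE (a : tree_aut T) l :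
  fixed_to_level a l = \bigcup_(v in [set v | a l v = v]) cylinder v.
Proof. by rewrite bigcup_cylinder. Qed.

Lemma measurable_fixed_to_level (a : tree_aut T) l :
  measurable (fixed_to_level a l : set (Borel (boundary T))).
Proof.
rewrite fixed_to_levelE; apply: fin_bigcup_measurable => [|v _];
  first exact: finite_finset.
exact: measurable_cylinder.
Qed.

Lemma measurable_fixed_points (a : tree_aut T) :
  measurable (fixed_points a : set (Borel (boundary T))).
Proof.
rewrite -bigcap_fixed_to_level; apply: bigcapT_measurable => l.
exact: measurable_fixed_to_level.
Qed.

Variables (R : realType) (m : probability (Borel (boundary T)) R).

Lemma counting_measure_cylinder l (v : vertex T l) :
  counting_measure m -> m (cylinder v) = (#|vertex T l|%:R^-1)%:E.
Proof.
move=> hm.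
apply: (@probability_equipartition R _ (Borel (boundary T)) m _ (@cylinder T l)).
- exact: measurable_cylinder.
- exact: trivIset_cylinder.
- by rewrite bigcup_cylinder.
- by move=> i j; rewrite !hm.
Qed.

(** An empty cylinder would have mass 0, not the inverse of a vertex count. *)
Lemma cylinder_nonempty l (v : vertex T l) :
  counting_measure m -> cylinder v !=set0.
Proof.
move=> hm; apply/set0P/eqP => v0; have := counting_measure_cylinder v hm.
have vT : (0 < #|vertex T l|)%N by apply/card_gt0P; exists v.
rewrite v0 measure0 => -[] /esym/eqP.
by rewrite invr_eq0 pnatr_eq0 -leqn0 leqNgt vT.
Qed.

(** Continuity from above: the differences decrease, and their intersection is empty because a path
    fixed at every level is a fixed point. *)
Lemma cvg_moved_fixed_to_level (a : tree_aut T) :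
  m (fixed_to_level a l `\` fixed_points a) @[l --> \oo] --> 0%E.
Proof.
pose D l : set (Borel (boundary T)) := fixed_to_level a l `\` fixed_points a.
have D0 : \bigcap_l D l = set0.
  rewrite -subset0 => w Dw; have [_] := Dw 0%N I; apply.
  by rewrite -bigcap_fixed_to_level => l _; have [] := Dw l I.
have mD l : measurable (D l).
  apply: measurableD; first exact: measurable_fixed_to_level.
  exact: measurable_fixed_points.
rewrite -(measure0 m) -D0; apply: nonincreasing_cvg_mu => //.
- by rewrite ltey_eq fin_num_measure//; exact: (mD 0%N).
- by rewrite [X in measurable X]D0; exact: measurable0.
- move=> i j ij; apply/subsetPset; apply: setSD.
  rewrite -(subnK ij); elim: (j - i)%N => // k; apply: subset_trans.
  exact: fixed_to_levelS.
Qed.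

Lemma nondegenerate_fixed_to_level (a : tree_aut T) :
  counting_measure m -> locally_nondegenerate_aut m a ->
  interior (fixed_points a) = set0 ->
  exists2 alpha : R, 0 < alpha & forall l,
    (alpha%:E * m (fixed_to_level a l)
       <= m (fixed_to_level a l `\` fixed_points a))%E.
Proof.
move=> hm [alpha /andP[alpha0 _] alphaP] int0; exists alpha => // l.
rewrite !fixed_to_levelE [X in (_ <= _ X)%E]setDE setI_bigcupl.
have mc := @measurable_cylinder l.
have mF := measurableC (measurable_fixed_points a).
rewrite !measure_fin_bigcup; last 6 first.
- exact: finite_finset.
- by move=> u v _ _ [w [[<- _] [<- _]]].
- by move=> v _; apply: measurableI.
- exact: finite_finset.
- exact: trivIset_cylinder.
- by [].
rewrite ge0_mule_fsumr//; apply: lee_fsum => [|v av]; first exact: finite_finset.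
(* If nothing below [v] moved, the nonempty open cylinder of [v] would lie in the fixed-point set,
   whose interior is empty. *)
apply: alphaP => //; apply: contrapT => nw.
have [w vw] := cylinder_nonempty v hm.
suff : interior (fixed_points a) w by rewrite int0.
rewrite /interior nbhsE; exists (cylinder v).
  by split => //; exact: open_cylinder.
by move=> u vu; apply: contrapT => au; apply: nw; exists u.
Qed.

End Boundary.

(** * From the counting measure on the boundary back to [mu] on [X] *)

Section Transfer.
Variables (R : realType) (G : groupType) (X : ptopologicalType).
Variables (Phi : homeo_action G X) (mu : probability (Borel X) R).
Variables (T : spherical_tree) (phi : X -> boundary T).
Hypothesis phi_homeo : homeomorphism phi.
Hypothesis hmin : minimal_action Phi.
Hypothesis hmu : invariant_measure Phi mu.
Hypothesis hind : forall g, exists a, induces Phi phi g a.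

Lemma measurable_preimage (U : set (boundary T)) :
  open U -> measurable (phi @^-1` U : set (Borel X)).
Proof.
move=> oU; apply: sub_sigma_algebra; apply: open_comp => // x _.
exact: phi_homeo.1.
Qed.

Variable m : probability (Borel (boundary T)) R.
Hypothesis hm : counting_measure m.

(* Minimality makes [G] transitive on each level, so the invariant measure
   gives the same mass to all cylinders of that level. *)
Lemma invariant_measure_cylinder l (v : vertex T l) :
  mu (phi @^-1` cylinder v) = m (cylinder v).
Proof.
have mcyl u : measurable (phi @^-1` @cylinder T l u : set (Borel X)).
  by apply: measurable_preimage; exact: open_cylinder.
rewrite counting_measure_cylinder//.
apply: (@probability_equipartition R _ (Borel X) mu _
  (fun v => phi @^-1` @cylinder T l v)).
- by [].
- by move=> i j _ _ [w [/= <- <-]].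
- by rewrite -preimage_bigcup bigcup_cylinder.
move=> u w; have [psi [_ _ psiK]] := phi_homeo.2.
have [y uy] := cylinder_nonempty u hm.
have [z wz] := cylinder_nonempty w hm.
have [x [/= wx [g _ gx]]] : phi @^-1` cylinder w `&`
    [set Phi g (psi y) | g in [set: G]] !=set0.
  apply: hmin; first by exists (psi z); rewrite /= psiK.
  by apply: open_comp => [x _|]; [exact: phi_homeo.1|exact: open_cylinder].
have [a ag] := hind g.
(* Invariance replaces the set over [w] by its pullback under [g]. This is the set over [u], because
   [a] is injective on the level and sends [u] to [w]. *)
rewrite -(hmu g (mcyl w)); congr (mu _).
have au : a l u = w by rewrite -wx -gx ag psiK /= uy.
apply/seteqP; split => t; rewrite /cylinder /= ag /=; first by move=> ->.
by rewrite -au => /aut_inj.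
Qed.

Lemma invariant_measure_fixed_to_level (a : tree_aut T) l :
  mu (phi @^-1` fixed_to_level a l) = m (fixed_to_level a l).
Proof.
rewrite !fixed_to_levelE preimage_bigcup !measure_fin_bigcup.
- by apply: eq_fsbigr => v _; exact: invariant_measure_cylinder.
- exact: finite_finset.
- exact: trivIset_cylinder.
- by move=> v _; exact: measurable_cylinder.
- exact: finite_finset.
- by move=> i j _ _ [w [/= <- <-]].
- by move=> v _; apply: measurable_preimage; exact: open_cylinder.
Qed.

(** The measures are compared on the sets U_l: with F the fixed-point set, alpha * mu(F) <= alpha *
    mu(U_l) = alpha * m(U_l) <= m(U_l \ F), which tends to 0. *)
Lemma negligible_fixed_points (a : tree_aut T) :
  locally_nondegenerate_aut m a -> interior (fixed_points a) = set0 ->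
  mu.-negligible (phi @^-1` fixed_points a).
Proof.
move=> anl int0.
have [alpha alpha0 alphaP] := nondegenerate_fixed_to_level hm anl int0.
have mU l : measurable (phi @^-1` fixed_to_level a l : set (Borel X)).
  rewrite fixed_to_levelE preimage_bigcup.
  apply: fin_bigcup_measurable => [|v _]; first exact: finite_finset.
  by apply: measurable_preimage; exact: open_cylinder.
have mF : measurable (phi @^-1` fixed_points a : set (Borel X)).
  rewrite -bigcap_fixed_to_level preimage_bigcap.
  exact: bigcapT_measurable.
apply/negligibleP => //; apply/eqP; rewrite eq_le measure_ge0 andbT.
rewrite -(@lee_pmul2l _ alpha%:E)// mule0.
apply: cvge_ge (cvg_moved_fixed_to_level m a); apply: nearW => l.
apply: le_trans (alphaP l).
rewrite -invariant_measure_fixed_to_level lee_pmul2l//; apply: le_measure.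
- by rewrite inE.
- by rewrite inE.
- by rewrite -bigcap_fixed_to_level => x; apply.
Qed.

End Transfer.

Theorem corollary1p10 (R : realType) (G : groupType) (X : ptopologicalType)
    (Phi : homeo_action G X) (mu : probability (Borel X) R)
    (hG : finitely_generated G)
    (hX : cantor_set X)
    (hmin : minimal_action Phi)
    (heq : equicontinuous_action R Phi)
    (hmu : invariant_measure Phi mu)
    (hlnd : locally_nondegenerate Phi R)
    (hfree : topologically_free Phi) :
  essentially_free Phi mu.
Proof.
have [c cP] := hX.
have hausX := homeomorphism_hausdorff cP cantor_space_hausdorff.
have compX := homeomorphism_compact cP cantor_space_compact.
have [T [phi [m [hphi hm hind hnd]]]] := hlnd.
have [f fP] := finitely_generated_countable hG.
(* With its second argument fixed, [stabilizer Phi ^~ g] is the fixed-point set of [g] in [X]. *)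
have fixN g : g <> 1%g -> mu.-negligible (stabilizer Phi ^~ g).
  move=> g1; have [a ag] := hind g.
  have -> : stabilizer Phi ^~ g = phi @^-1` fixed_points a.
    have [_ [psi [_ phiK _]]] := hphi.
    apply/seteqP; split => x; rewrite /stabilizer /fixed_points /= -ag.
      by move=> ->.
    exact: (can_inj phiK).
  apply: (negligible_fixed_points hphi hmin hmu hind hm).
    by apply: hnd; exists g.
  have [psi [cpsi phiK psiK]] := hphi.2.
  (* Pulled back to [X], the interior is open, and it is meager since all its points are fixed by
     [g <> 1]. Baire makes it empty, yet it would contain [psi w]. *)
  rewrite -subset0 => w wi.
  have oV : open (phi @^-1` interior (fixed_points a)).
    apply: open_comp; last exact: open_interior.
    by move=> x _; exact: hphi.1.
  have V0 := compact_hausdorff_baire hausX compX oV.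
  suff : set0 (psi w) by [].
  rewrite -V0 /=; first by rewrite psiK.
  have [F [ndF sF]] := hfree; exists F; split => // x Vx; apply: sF => /= st.
  apply: g1; suff : stabilizer Phi x g by rewrite st.
  by apply: (can_inj phiK); rewrite ag; exact: (interior_subset Vx).
(* Indices with [f n = 1] contribute [set0], as the identity fixes all of [X]. *)
apply: (@negligibleS _ _ _ mu (\bigcup_n
  (if f n == 1%g then set0 else stabilizer Phi ^~ (f n)))); last first.
  apply: negligible_bigcup => n; case: eqP => [_|/fixN//].
  exact: negligible_set0.
(* The action of 1 is idempotent and injective, hence the identity. *)
have st1 x : stabilizer Phi x 1%g.
  have [_ [psi [_ PK _]]] := act_homeo Phi 1%g.
  by apply: (can_inj PK); rewrite -act_mul mulg1.
move=> x nx; apply: contrapT => nU; apply: nx; apply/seteqP; split => [g gx|_ ->//].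
apply: contrapT => g1; apply: nU; have [n fn] := fP g; exists n => //.
by case: eqP => //; rewrite fn.
Qed.
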